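(* Let $\mathcal P$ be a PRO. The strict representations $(\mathbf S_\bullet,l^S):\mathcal P\to\mathrm{End}_{\mathcal C}(\mathcal M)$ by $\mathcal C$-equivariant endofunctors, in varying $\mathcal C$-actegories $\mathcal M$, are the objects of a 2-category $\mathrm{Rep}_{\mathcal C\mathbf{-act}^c}(\mathcal P)$ whose 1-cells are the (colax) maps of pairs and whose 2-cells are the transformations of maps of pairs. Moreover, the maps of pairs $(K,\zeta^K,\alpha)$ whose coherence $\zeta^K$ is invertible are the 1-cells of a 2-subcategory $\mathrm{Rep}_{\mathcal C\mathbf{-act}^p}(\mathcal P)\subset\mathrm{Rep}_{\mathcal C\mathbf{-act}^c}(\mathcal P)$.
   Context: A PRO is a strict monoidal category whose objects are the natural numbers (including $0$), with tensor product on objects the addition and unit object $0$. A strict representation of $\mathcal P$ in a strict monoidal category $\mathcal E$ is a strict monoidal functor $\mathcal P\to\mathcal E$. $\mathcal C$ is a fixed monoidal category with product $\otimes$, unit $\mathbf 1$, associativity isomorphisms $a_{X,Y,Z}:X\otimes(Y\otimes Z)\to(X\otimes Y)\otimes Z$ and unit isomorphisms $l_A:\mathbf 1\otimes A\to A$, $r_A:A\otimes\mathbf 1\to A$. A $\mathcal C$-actegory is a category $\mathcal N$ with a bifunctor $\lozenge:\mathcal C\times\mathcal N\to\mathcal N$ and natural isomorphisms $\Psi_{Q,Q',N}:(Q\otimes Q')\lozenge N\to Q\lozenge(Q'\lozenge N)$, $u_N:\mathbf 1\lozenge N\to N$ such that $\Psi_{Q,Q',Q''\lozenge N}\circ\Psi_{Q\otimes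 Q',Q'',N}\circ(a_{Q,Q',Q''}\lozenge N)=(Q\lozenge\Psi_{Q',Q'',N})\circ\Psi_{Q,Q'\otimes Q'',N}$, $u_{Q\lozenge N}\circ\Psi_{\mathbf 1,Q,N}=l_Q\lozenge N$, $(Q\lozenge u_N)\circ\Psi_{Q,\mathbf 1,N}=r_Q\lozenge N$. A colax $\mathcal C$-equivariant functor $(F,\zeta):\mathcal M\to\mathcal N$ is a functor $F$ with a binatural transformation $\zeta_{C,M}:F(C\lozenge M)\to C\lozenge F(M)$ with $u_{F(M)}\circ\zeta_{\mathbf 1,M}=F(u_M)$ and $\Psi_{A,B,F(M)}\circ\zeta_{A\otimes B,M}=(A\lozenge\zeta_{B,M})\circ\zeta_{A,B\lozenge M}\circ F(\Psi_{A,B,M})$. A natural transformation $\alpha:F\Rightarrow G$ is $\mathcal C$-equivariant $(F,\zeta^F)\Rightarrow(G,\zeta^G)$ if $(C\lozenge\alpha_M)\circ\zeta^F_{C,M}=\zeta^G_{C,M}\circ\alpha_{C\lozenge M}$. $\mathrm{End}_{\mathcal C}(\mathcal M)$ is the strict monoidal category of colax $\mathcal C$-equivariant endofunctors of $\mathcal M$ and equivariant natural transformations, with tensor product $(F,\zeta^F)\circ(G,\zeta^G)=(FG,\zeta^{FG})$, $\zeta^{FG}_{C,M}=\zeta^F_{C,GM}\circ F(\zeta^G_{C,M})$. A representation $\mathcal P\to\mathrm{End}_{\mathcal C}(\mathcal M)$ is written $(\mathbf S_\bullet,l^S)$: $\mathbf S_\bullet$ is the underlying representation in endofunctors, $S=\mathbf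 S_\bullet(1)$, $\mathbf S_\bullet(n)=S^n$, and $l^S_{C,M}:S(C\lozenge M)\to C\lozenge SM$ is the coherence of the image $(S,l^S)$ of $1$. For fixed $C$ write $G^{\mathcal M}=C\lozenge^{\mathcal M}\_$ and regard $l^S:SG^{\mathcal M}\Rightarrow G^{\mathcal M}S$. A (colax) map of pairs $(K,\zeta^K,\alpha):(\mathbf T_\bullet,l^T)\to(\mathbf S_\bullet,l^S)$, with $\mathbf S_\bullet$ on $\mathcal M$ and $\mathbf T_\bullet$ on $\mathcal N$, is a colax $\mathcal C$-equivariant functor $(K,\zeta^K):\mathcal M\to\mathcal N$ with a natural transformation $\alpha:TK\Rightarrow KS$ such that $G^{\mathcal N}\alpha\circ l^TK\circ T\zeta^K=\zeta^KS\circ Kl^S\circ\alpha G^{\mathcal M}$ for all $C$, and for every $\tau:n\to p$ in $\mathcal P$, $K\tau^S\circ\alpha^{(n)}=\alpha^{(p)}\circ\tau^TK$, where $\tau^T=\mathbf T_\bullet(\tau)$, $\tau^S=\mathbf S_\bullet(\tau)$ and $\alpha^{(n)}=\alpha S^{n-1}\circ T\alpha S^{n-2}\circ\cdots\circ T^{n-1}\alpha:T^nK\Rightarrow KS^n$ (identity for $n=0$). It may be thought of as an intertwiner from $(\mathbf S_\bullet,l^S)$ to $(\mathbf T_\bullet,l^T)$. Composition of $(L,\zeta^L,\beta):(\mathbf V_\bullet,l^V)\to(\mathbf T_\bullet,l^T)$ and $(K,\zeta^K,\alpha)$ is $(L,\zeta^L,\beta)\circ(K,\zeta^K,\alpha)=(LK,\zeta^LK\circ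 L\zeta^K,L\alpha\circ\beta K):(\mathbf V_\bullet,l^V)\to(\mathbf S_\bullet,l^S)$. A transformation of maps of pairs $\sigma:(K,\zeta^K,\alpha)\Rightarrow(L,\zeta^L,\beta):(\mathbf T_\bullet,l^T)\to(\mathbf S_\bullet,l^S)$ is a natural transformation $\sigma:K\Rightarrow L$ with $\beta\circ T\sigma=\sigma S\circ\alpha$ and $(C\lozenge\sigma_M)\circ\zeta^K_{C,M}=\zeta^L_{C,M}\circ\sigma_{C\lozenge M}$ for all $C,M$. Compositions of 2-cells are the usual vertical and horizontal compositions of natural transformations. *)

(* Defs.v *)
From Stdlib Require Import ssreflect PeanoNat.
From Stdlib Require Import FunctionalExtensionality ProofIrrelevance.

Set Implicit Arguments.
Unset Strict Implicit.
Unset Printing Implicit Defensive.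

#[local] Obligation Tactic := simpl; try done.

(* Morphisms of a category are compared with Leibniz equality.  The collection
   of objects is a parameter of [CategoryOn], so that a category "whose objects
   are the natural numbers" can be prescribed literally. *)
Record CategoryOn (O : Type) := {
  hom_on : O -> O -> Type;
  idm_on : forall X, hom_on X X;
  comp_on : forall X Y Z, hom_on Y Z -> hom_on X Y -> hom_on X Z;
  comp_on_assoc : forall X Y Z W
      (h : hom_on Z W) (g : hom_on Y Z) (f : hom_on X Y),
    comp_on h (comp_on g f) = comp_on (comp_on h g) f;
  comp_on_idl : forall X Y (f : hom_on X Y), comp_on (idm_on Y) f = f;
  comp_on_idr : forall X Y (f : hom_on X Y), comp_on f (idm_on X) = f
}.

Record Category := {
  Ob :> Type;
  cat_on : CategoryOn Ob
}.

Definition Hom (A : Category) (X Y : A) : Type := hom_on (cat_on A) X Y.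
Definition idm (A : Category) (X : A) : Hom X X := idm_on (cat_on A) X.
Definition comp (A : Category) (X Y Z : A) (g : Hom Y Z) (f : Hom X Y) :
  Hom X Z := comp_on g f.

Arguments Hom : simpl never.
Arguments idm : simpl never.
Arguments comp : simpl never.

Notation "g ∘ f" := (comp g f) (at level 40, left associativity).

Lemma compA (A : Category) (X Y Z W : A)
  (h : Hom Z W) (g : Hom Y Z) (f : Hom X Y) : h ∘ (g ∘ f) = (h ∘ g) ∘ f.
Proof. exact: comp_on_assoc. Qed.

Lemma comp1m (A : Category) (X Y : A) (f : Hom X Y) : idm Y ∘ f = f.
Proof. exact: comp_on_idl. Qed.

Lemma compm1 (A : Category) (X Y : A) (f : Hom X Y) : f ∘ idm X = f.
Proof. exact: comp_on_idr. Qed.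

Definition IsIso (A : Category) (X Y : A) (f : Hom X Y) : Prop :=
  exists g : Hom Y X, g ∘ f = idm X /\ f ∘ g = idm Y.

(* Transport of a morphism along equalities of its source and target. *)
Definition hom_cast (A : Category) (X X' Y Y' : A)
    (e : X = X') (e' : Y = Y') (f : Hom X Y) : Hom X' Y' :=
  match e in _ = U, e' in _ = V return Hom U V with
  | eq_refl, eq_refl => f
  end.

Record Functor (A B : Category) := {
  fobj :> A -> B;
  fmap : forall X Y, Hom X Y -> Hom (fobj X) (fobj Y);
  fmap_id : forall X, fmap (idm X) = idm (fobj X);
  fmap_comp : forall X Y Z (g : Hom Y Z) (f : Hom X Y),
    fmap (g ∘ f) = fmap g ∘ fmap f
}.

Record NatTrans (A B : Category) (F G : Functor A B) := {
  ncomp :> forall X : A, Hom (F X) (G X);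
  ncomp_nat : forall X Y (f : Hom X Y),
    ncomp Y ∘ fmap F f = fmap G f ∘ ncomp X
}.

Lemma nat_eq (A B : Category) (F G : Functor A B) (s t : NatTrans F G) :
  (forall X, s X = t X) -> s = t.
Proof.
case: s => s ps; case: t => t pt /= E.
have Est : s = t by apply: functional_extensionality_dep.
by subst t; congr Build_NatTrans; apply: proof_irrelevance.
Qed.

Program Definition functor_id (A : Category) : Functor A A :=
  {| fobj := fun X => X; fmap := fun X Y f => f |}.

Program Definition functor_comp (A B D : Category)
    (G : Functor B D) (F : Functor A B) : Functor A D :=
  {| fobj := fun X => G (F X); fmap := fun X Y f => fmap G (fmap F f) |}.
Next Obligation. by move=> *; rewrite !fmap_id. Qed.
Next Obligation. by move=> *; rewrite !fmap_comp. Qed.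

Program Definition nat_id (A B : Category) (F : Functor A B) : NatTrans F F :=
  {| ncomp := fun X => idm (F X) |}.
Next Obligation. by move=> *; rewrite comp1m compm1. Qed.

Program Definition nat_vcomp (A B : Category) (F G H : Functor A B)
    (t : NatTrans G H) (s : NatTrans F G) : NatTrans F H :=
  {| ncomp := fun X => t X ∘ s X |}.
Next Obligation.
by move=> *; rewrite -compA ncomp_nat compA ncomp_nat -compA.
Qed.

(* For t : G => G' and s : F => F', the horizontal composite GF => G'F'. *)
Program Definition nat_hcomp (A B D : Category) (G G' : Functor B D)
    (F F' : Functor A B) (t : NatTrans G G') (s : NatTrans F F') :
    NatTrans (functor_comp G F) (functor_comp G' F') :=
  {| ncomp := fun X => t (F' X) ∘ fmap G (s X) |}.
Next Obligation.
move=> A B D G G' F F' t s X Y f /=.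
by rewrite -compA -fmap_comp (ncomp_nat s) fmap_comp compA (ncomp_nat t) -compA.
Qed.

Record StrictMonoidalOn (A : Category) (I : A) (T : A -> A -> A) := {
  stens : forall X Y X' Y',
    Hom X X' -> Hom Y Y' -> Hom (T X Y) (T X' Y');
  stens_id : forall X Y, stens (idm X) (idm Y) = idm (T X Y);
  stens_comp : forall X Y Z X' Y' Z' (g : Hom Y Z) (f : Hom X Y)
      (g' : Hom Y' Z') (f' : Hom X' Y'),
    stens (g ∘ f) (g' ∘ f') = stens g g' ∘ stens f f';
  s_assoc : forall X Y Z, T X (T Y Z) = T (T X Y) Z;
  s_unitl : forall X, T I X = X;
  s_unitr : forall X, T X I = X;
  stens_assoc : forall X Y Z X' Y' Z'
      (f : Hom X X') (g : Hom Y Y') (h : Hom Z Z'),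
    hom_cast (s_assoc X Y Z) (s_assoc X' Y' Z') (stens f (stens g h))
    = stens (stens f g) h;
  stens_unitl : forall X Y (f : Hom X Y),
    hom_cast (s_unitl X) (s_unitl Y) (stens (idm I) f) = f;
  stens_unitr : forall X Y (f : Hom X Y),
    hom_cast (s_unitr X) (s_unitr Y) (stens f (idm I)) = f
}.

Record StrictMonoidalCategory := {
  smc_cat :> Category;
  sunit : smc_cat;
  sobj : smc_cat -> smc_cat -> smc_cat;
  smc_on : StrictMonoidalOn sunit sobj
}.

Record StrictMonoidalFunctor (A B : StrictMonoidalCategory) := {
  smf_fun :> Functor A B;
  smf_unit : smf_fun (sunit A) = sunit B;
  smf_tens : forall X Y, smf_fun (sobj X Y) = sobj (smf_fun X) (smf_fun Y);
  smf_tens_map : forall X Y X' Y' (f : Hom X X') (g : Hom Y Y'),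
    hom_cast (smf_tens X Y) (smf_tens X' Y')
      (fmap smf_fun (stens (smc_on A) f g))
    = stens (smc_on B) (fmap smf_fun f) (fmap smf_fun g)
}.

Record PRO := {
  pro_on : CategoryOn nat;
  pro_cat := {| Ob := nat; cat_on := pro_on |} : Category;
  pro_smon : @StrictMonoidalOn pro_cat 0 Nat.add
}.

Definition pro_smc (P : PRO) : StrictMonoidalCategory :=
  {| smc_cat := pro_cat P; sunit := 0; sobj := Nat.add; smc_on := pro_smon P |}.
Coercion pro_smc : PRO >-> StrictMonoidalCategory.

Record MonoidalCategory := {
  mc_cat :> Category;
  mtens : mc_cat -> mc_cat -> mc_cat;
  munit : mc_cat;
  mtens_map : forall X Y X' Y' : mc_cat,
    Hom X X' -> Hom Y Y' -> Hom (mtens X Y) (mtens X' Y');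
  mtens_id : forall X Y, mtens_map (idm X) (idm Y) = idm (mtens X Y);
  mtens_comp : forall X Y Z X' Y' Z' (g : Hom Y Z) (f : Hom X Y)
      (g' : Hom Y' Z') (f' : Hom X' Y'),
    mtens_map (g ∘ f) (g' ∘ f') = mtens_map g g' ∘ mtens_map f f';
  massoc : forall X Y Z, Hom (mtens X (mtens Y Z)) (mtens (mtens X Y) Z);
  mlunit : forall X, Hom (mtens munit X) X;
  mrunit : forall X, Hom (mtens X munit) X;
  massoc_iso : forall X Y Z, IsIso (massoc X Y Z);
  mlunit_iso : forall X, IsIso (mlunit X);
  mrunit_iso : forall X, IsIso (mrunit X);
  massoc_nat : forall X Y Z X' Y' Z'
      (f : Hom X X') (g : Hom Y Y') (h : Hom Z Z'),
    massoc X' Y' Z' ∘ mtens_map f (mtens_map g h)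
    = mtens_map (mtens_map f g) h ∘ massoc X Y Z;
  mlunit_nat : forall X X' (f : Hom X X'),
    mlunit X' ∘ mtens_map (idm munit) f = f ∘ mlunit X;
  mrunit_nat : forall X X' (f : Hom X X'),
    mrunit X' ∘ mtens_map f (idm munit) = f ∘ mrunit X;
  mpentagon : forall X Y Z W,
    massoc (mtens X Y) Z W ∘ massoc X Y (mtens Z W)
    = mtens_map (massoc X Y Z) (idm W) ∘ massoc X (mtens Y Z) W
      ∘ mtens_map (idm X) (massoc Y Z W);
  mtriangle : forall X Y,
    mtens_map (mrunit X) (idm Y) ∘ massoc X munit Y
    = mtens_map (idm X) (mlunit Y)
}.

Notation "X ⊗ Y" := (mtens X Y) (at level 35, right associativity).

Record Actegory (C : MonoidalCategory) := {
  act_cat :> Category;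
  act : C -> act_cat -> act_cat;
  act_map : forall (Q Q' : C) (N N' : act_cat),
    Hom Q Q' -> Hom N N' -> Hom (act Q N) (act Q' N');
  act_id : forall Q N, act_map (idm Q) (idm N) = idm (act Q N);
  act_comp : forall (Q Q' Q'' : C) (N N' N'' : act_cat)
      (g : Hom Q' Q'') (f : Hom Q Q') (g' : Hom N' N'') (f' : Hom N N'),
    act_map (g ∘ f) (g' ∘ f') = act_map g g' ∘ act_map f f';
  actPsi : forall (Q Q' : C) (N : act_cat),
    Hom (act (Q ⊗ Q') N) (act Q (act Q' N));
  actu : forall N, Hom (act (munit C) N) N;
  actPsi_iso : forall Q Q' N, IsIso (actPsi Q Q' N);
  actu_iso : forall N, IsIso (actu N);
  actPsi_nat : forall (Q1 Q2 Q1' Q2' : C) (N N' : act_cat)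
      (f : Hom Q1 Q1') (g : Hom Q2 Q2') (h : Hom N N'),
    actPsi Q1' Q2' N' ∘ act_map (mtens_map f g) h
    = act_map f (act_map g h) ∘ actPsi Q1 Q2 N;
  actu_nat : forall N N' (h : Hom N N'),
    actu N' ∘ act_map (idm (munit C)) h = h ∘ actu N;
  act_pentagon : forall (Q Q' Q'' : C) N,
    actPsi Q Q' (act Q'' N) ∘ actPsi (Q ⊗ Q') Q'' N
      ∘ act_map (massoc Q Q' Q'') (idm N)
    = act_map (idm Q) (actPsi Q' Q'' N) ∘ actPsi Q (Q' ⊗ Q'') N;
  act_unitl : forall Q N,
    actu (act Q N) ∘ actPsi (munit C) Q N = act_map (mlunit Q) (idm N);
  act_unitr : forall Q N,
    act_map (idm Q) (actu N) ∘ actPsi Q (munit C) N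
    = act_map (mrunit Q) (idm N)
}.

Notation "Q ◊ N" := (act Q N) (at level 35, right associativity).

Record ColaxFunctor (C : MonoidalCategory) (M N : Actegory C) := {
  cf_fun :> Functor M N;
  cf_zeta : forall (c : C) (m : M), Hom (cf_fun (c ◊ m)) (c ◊ cf_fun m);
  cf_zeta_nat : forall (c c' : C) (m m' : M) (f : Hom c c') (g : Hom m m'),
    cf_zeta c' m' ∘ fmap cf_fun (act_map f g)
    = act_map f (fmap cf_fun g) ∘ cf_zeta c m;
  cf_zeta_unit : forall m,
    actu (cf_fun m) ∘ cf_zeta (munit C) m = fmap cf_fun (actu m);
  cf_zeta_tens : forall (a b : C) (m : M),
    actPsi a b (cf_fun m) ∘ cf_zeta (a ⊗ b) m
    = act_map (idm a) (cf_zeta b m) ∘ cf_zeta a (b ◊ m)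
      ∘ fmap cf_fun (actPsi a b m)
}.

Definition IsEquivariant (C : MonoidalCategory) (M N : Actegory C)
    (F G : ColaxFunctor M N) (s : NatTrans F G) : Prop :=
  forall (c : C) (m : M),
    act_map (idm c) (s m) ∘ cf_zeta F c m = cf_zeta G c m ∘ s (c ◊ m).

Record EquivNat (C : MonoidalCategory) (M N : Actegory C)
    (F G : ColaxFunctor M N) := {
  en_nat :> NatTrans F G;
  en_equiv : IsEquivariant en_nat
}.

Lemma en_eq (C : MonoidalCategory) (M N : Actegory C)
  (F G : ColaxFunctor M N) (s t : EquivNat F G) :
  (forall m, s m = t m) -> s = t.
Proof.
case: s => s ps; case: t => t pt /= E.
have Est : s = t by apply: nat_eq.
by subst t; congr Build_EquivNat; apply: proof_irrelevance.
Qed.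

Program Definition colax_id (C : MonoidalCategory) (M : Actegory C) :
    ColaxFunctor M M :=
  {| cf_fun := functor_id M; cf_zeta := fun c m => idm (c ◊ m) |}.
Next Obligation. by move=> *; rewrite comp1m compm1. Qed.
Next Obligation. by move=> *; rewrite compm1. Qed.
Next Obligation. by move=> *; rewrite act_id compm1 !comp1m. Qed.

Program Definition colax_comp (C : MonoidalCategory) (M N O : Actegory C)
    (F : ColaxFunctor N O) (G : ColaxFunctor M N) : ColaxFunctor M O :=
  {| cf_fun := functor_comp F G;
     cf_zeta := fun c m => cf_zeta F c (G m) ∘ fmap F (cf_zeta G c m) |}.
Next Obligation.
move=> C M N O F G c c' m m' f g /=.
rewrite -compA -fmap_comp cf_zeta_nat fmap_comp compA cf_zeta_nat.
by rewrite -compA.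
Qed.
Next Obligation.
move=> C M N O F G m /=.
by rewrite compA cf_zeta_unit -fmap_comp cf_zeta_unit.
Qed.
Next Obligation.
move=> C M N O F G a b m /=.
rewrite compA cf_zeta_tens -!compA -fmap_comp cf_zeta_tens.
rewrite !fmap_comp -[idm a](comp1m (idm a)) act_comp comp1m.
rewrite !compA; congr (_ ∘ _); congr (_ ∘ _).
by rewrite -!compA; congr (_ ∘ _); rewrite cf_zeta_nat.
Qed.

Program Definition en_id (C : MonoidalCategory) (M N : Actegory C)
    (F : ColaxFunctor M N) : EquivNat F F := {| en_nat := nat_id F |}.
Next Obligation. by move=> C M N F c m /=; rewrite act_id comp1m compm1. Qed.

Program Definition en_vcomp (C : MonoidalCategory) (M N : Actegory C)
    (F G H : ColaxFunctor M N) (t : EquivNat G H) (s : EquivNat F G) :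
    EquivNat F H := {| en_nat := nat_vcomp t s |}.
Next Obligation.
move=> C M N F G H t s c m /=.
rewrite -{1}[idm c](comp1m (idm c)) act_comp -compA (en_equiv s).
by rewrite compA (en_equiv t) -compA.
Qed.

Program Definition en_hcomp (C : MonoidalCategory) (M N O : Actegory C)
    (G G' : ColaxFunctor N O) (F F' : ColaxFunctor M N)
    (t : EquivNat G G') (s : EquivNat F F') :
    EquivNat (colax_comp G F) (colax_comp G' F') :=
  {| en_nat := nat_hcomp t s |}.
Next Obligation.
move=> C M N O G G' F F' t s c m /=.
rewrite -{1}[idm c](comp1m (idm c)) act_comp -compA.
rewrite (compA _ (cf_zeta G c (F m))) -cf_zeta_nat -compA -fmap_comp.
rewrite (en_equiv s) fmap_comp !compA (en_equiv t); congr (_ ∘ _).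
by rewrite -!compA ncomp_nat.
Qed.

Program Definition colax_cat (C : MonoidalCategory) (M N : Actegory C) :
    Category :=
  {| Ob := ColaxFunctor M N;
     cat_on := {|
       hom_on := fun F G => EquivNat F G;
       idm_on := fun F => en_id F;
       comp_on := fun F G H t s => en_vcomp t s |} |}.
Next Obligation. by move=> *; apply: en_eq => m /=; rewrite compA. Qed.
Next Obligation. by move=> *; apply: en_eq => m /=; rewrite comp1m. Qed.
Next Obligation. by move=> *; apply: en_eq => m /=; rewrite compm1. Qed.

Lemma colax_eq (C : MonoidalCategory) (M N : Actegory C) (o : M -> N)
    (f : forall X Y, Hom X Y -> Hom (o X) (o Y)) i1 i2 c1 c2
    (z1 z2 : forall (c : C) (m : M), Hom (o (c ◊ m)) (c ◊ o m))
    n1 n2 u1 u2 t1 t2 :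
  (forall c m, z1 c m = z2 c m) ->
  @Build_ColaxFunctor C M N (@Build_Functor M N o f i1 c1) z1 n1 u1 t1
  = @Build_ColaxFunctor C M N (@Build_Functor M N o f i2 c2) z2 n2 u2 t2.
Proof.
move=> E; have Ez : z1 = z2.
  apply: functional_extensionality_dep => c.
  by apply: functional_extensionality_dep => m.
have Ei : i1 = i2 by apply: proof_irrelevance.
have Ec : c1 = c2 by apply: proof_irrelevance.
by subst z2 i2 c2; congr Build_ColaxFunctor; apply: proof_irrelevance.
Qed.

Lemma hom_cast_id (A : Category) (X Y : A) (e : X = X) (e' : Y = Y)
  (f : Hom X Y) : hom_cast e e' f = f.
Proof.
by rewrite (proof_irrelevance _ e eq_refl) (proof_irrelevance _ e' eq_refl).
Qed.

Lemma en_cast (C : MonoidalCategory) (M N : Actegory C)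
    (F F' G G' : colax_cat M N) (e : F = F') (e' : G = G') (s : Hom F G) (m : M) :
  (hom_cast e e' s : EquivNat F' G') m
  = hom_cast (f_equal (fun H : ColaxFunctor M N => H m) e)
             (f_equal (fun H : ColaxFunctor M N => H m) e') ((s : EquivNat F G) m).
Proof. by case: F' / e; case: G' / e'. Qed.

Lemma colax_compA (C : MonoidalCategory) (M N O Q : Actegory C)
    (F : ColaxFunctor O Q) (G : ColaxFunctor N O) (H : ColaxFunctor M N) :
  colax_comp F (colax_comp G H) = colax_comp (colax_comp F G) H.
Proof. by apply: colax_eq => c m /=; rewrite fmap_comp compA. Qed.

Lemma colax_comp1l (C : MonoidalCategory) (M N : Actegory C)
    (F : ColaxFunctor M N) : colax_comp (colax_id N) F = F.
Proof.
by case: F => [[o f i c] z n u t]; apply: colax_eq => /= x m; rewrite comp1m.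
Qed.

Lemma colax_comp1r (C : MonoidalCategory) (M N : Actegory C)
    (F : ColaxFunctor M N) : colax_comp F (colax_id M) = F.
Proof.
case: F => [[o f i c] z n u t]; apply: colax_eq => /= x m.
by rewrite i compm1.
Qed.

Program Definition EndC (C : MonoidalCategory) (M : Actegory C) :
    StrictMonoidalCategory :=
  {| smc_cat := colax_cat M M;
     sunit := colax_id M;
     sobj := fun F G => colax_comp F G;
     smc_on := {|
       stens := fun F G F' G' t s => en_hcomp t s;
       s_assoc := fun F G H => colax_compA F G H;
       s_unitl := fun F => colax_comp1l F;
       s_unitr := fun F => colax_comp1r F |} |}.
Next Obligation.
by move=> C M F G; apply: en_eq => m /=; rewrite fmap_id comp1m.
Qed.
Next Obligation.
move=> C M F G H F' G' H' g f g' f'; apply: en_eq => m /=.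
rewrite fmap_comp -!compA; congr (_ ∘ _).
by rewrite !compA ncomp_nat.
Qed.
Next Obligation.
move=> C M F G H F' G' H' f g h; apply: en_eq => m.
by rewrite en_cast hom_cast_id /= fmap_comp compA.
Qed.
Next Obligation.
move=> C M F G s; apply: en_eq => m.
by rewrite en_cast hom_cast_id /= comp1m.
Qed.
Next Obligation.
move=> C M F G s; apply: en_eq => m.
by rewrite en_cast hom_cast_id /= fmap_id compm1.
Qed.

Record EquivRep (C : MonoidalCategory) (P : PRO) := {
  rep_act : Actegory C;
  rep_fun : StrictMonoidalFunctor P (EndC rep_act)
}.

(* (S, l^S), the image of 1; its coherence [cf_zeta (rep_gen X)] is l^S. *)
Definition rep_gen (C : MonoidalCategory) (P : PRO) (X : EquivRep C P) :
    ColaxFunctor (rep_act X) (rep_act X) := rep_fun X 1.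

Fixpoint colax_pow (C : MonoidalCategory) (M : Actegory C)
    (F : ColaxFunctor M M) (n : nat) : ColaxFunctor M M :=
  match n with
  | 0 => colax_id M
  | S k => colax_comp F (colax_pow F k)
  end.

Lemma rep_fun_pow (C : MonoidalCategory) (P : PRO) (X : EquivRep C P) (n : nat) :
  (rep_fun X n : EndC (rep_act X)) = colax_pow (rep_gen X) n.
Proof.
elim: n => [|n IHn] /=; first exact: (smf_unit (rep_fun X)).
by rewrite -IHn; exact: (@smf_tens _ _ (rep_fun X) 1 n).
Qed.

(* The image of an operation [tau : n -> p], as a transformation S^n => S^p:
   strictness makes the image of n equal to S^n only propositionally. *)
Definition rep_map (C : MonoidalCategory) (P : PRO) (X : EquivRep C P)
    (n p : nat) (tau : @Hom P n p) :
    EquivNat (colax_pow (rep_gen X) n) (colax_pow (rep_gen X) p) :=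
  @hom_cast (EndC (rep_act X)) _ _ _ _ (rep_fun_pow X n) (rep_fun_pow X p)
    (fmap (rep_fun X) tau).

(* For a map of pairs (T, l^T) -> (S, l^S) the functor K goes from the actegory
   of the target S to the actegory of the source T. *)
Record PairMapData (C : MonoidalCategory) (P : PRO) (T S : EquivRep C P) := {
  pm_fun : ColaxFunctor (rep_act S) (rep_act T);
  pm_alpha : NatTrans (functor_comp (rep_gen T) pm_fun)
                      (functor_comp pm_fun (rep_gen S))
}.

(* The components of alpha^(n) : T^n K => K S^n, computed by the recursion
   alpha^(0) = id, alpha^(n+1) = alpha S^n o T alpha^(n). *)
Fixpoint pm_alpha_pow (C : MonoidalCategory) (P : PRO) (T S : EquivRep C P)
    (K : PairMapData T S) (n : nat) (m : rep_act S) {struct n} :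
    Hom (colax_pow (rep_gen T) n (pm_fun K m))
        (pm_fun K (colax_pow (rep_gen S) n m)) :=
  match n return Hom (colax_pow (rep_gen T) n (pm_fun K m))
                     (pm_fun K (colax_pow (rep_gen S) n m)) with
  | 0 => idm (pm_fun K m)
  | S k => pm_alpha K (colax_pow (rep_gen S) k m)
            ∘ fmap (rep_gen T) (pm_alpha_pow K k m)
  end.

Record IsPairMap (C : MonoidalCategory) (P : PRO) (T S : EquivRep C P)
    (K : PairMapData T S) : Prop := {
  pm_coherence : forall (c : C) (m : rep_act S),
    act_map (idm c) (pm_alpha K m) ∘ cf_zeta (rep_gen T) c (pm_fun K m)
      ∘ fmap (rep_gen T) (cf_zeta (pm_fun K) c m)
    = cf_zeta (pm_fun K) c (rep_gen S m)
      ∘ fmap (pm_fun K) (cf_zeta (rep_gen S) c m)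
      ∘ pm_alpha K (c ◊ m);
  pm_intertwine : forall (n p : nat) (tau : @Hom P n p) (m : rep_act S),
    fmap (pm_fun K) (rep_map S tau m) ∘ pm_alpha_pow K n m
    = pm_alpha_pow K p m ∘ rep_map T tau (pm_fun K m)
}.

Record PairMap (C : MonoidalCategory) (P : PRO) (T S : EquivRep C P) := {
  pm_data :> PairMapData T S;
  pm_ok : IsPairMap pm_data
}.

Record IsPairTrans (C : MonoidalCategory) (P : PRO) (T S : EquivRep C P)
    (K L : PairMapData T S) (s : NatTrans (pm_fun K) (pm_fun L)) : Prop := {
  pt_alpha : forall m,
    pm_alpha L m ∘ fmap (rep_gen T) (s m) = s (rep_gen S m) ∘ pm_alpha K m;
  pt_equiv : IsEquivariant s
}.

Record PairTrans (C : MonoidalCategory) (P : PRO) (T S : EquivRep C P)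
    (K L : PairMapData T S) := {
  pt_nat :> NatTrans (pm_fun K) (pm_fun L);
  pt_ok : IsPairTrans pt_nat
}.

Program Definition pm_id_data (C : MonoidalCategory) (P : PRO)
    (S : EquivRep C P) : PairMapData S S :=
  {| pm_fun := colax_id (rep_act S);
     pm_alpha := {| ncomp := fun m => idm (rep_gen S m) |} |}.
Next Obligation. by move=> *; rewrite comp1m compm1. Qed.

Program Definition pm_comp_data (C : MonoidalCategory) (P : PRO)
    (V T S : EquivRep C P) (L : PairMapData V T) (K : PairMapData T S) :
    PairMapData V S :=
  {| pm_fun := colax_comp (pm_fun L) (pm_fun K);
     pm_alpha := {| ncomp := fun m =>
       fmap (pm_fun L) (pm_alpha K m) ∘ pm_alpha L (pm_fun K m) |} |}.
Next Obligation.
move=> C P V T S L K X Y f /=.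
have HK := ncomp_nat (pm_alpha K) f.
have HL := ncomp_nat (pm_alpha L) (fmap (pm_fun K) f).
rewrite /= in HK HL.
by rewrite -compA HL compA -fmap_comp HK fmap_comp compA.
Qed.

(* [comp1] is written in diagrammatic order.  With f : T -> S going along a
   functor in the opposite direction, this is the order in which the underlying
   functors are composed. *)
Record TwoCatData := {
  cell0 :> Type;
  cell1 : cell0 -> cell0 -> Type;
  cell2 : forall x y, cell1 x y -> cell1 x y -> Type;
  id1 : forall x, cell1 x x;
  comp1 : forall x y z, cell1 x y -> cell1 y z -> cell1 x z;
  id2 : forall x y (f : cell1 x y), cell2 f f;
  vcomp : forall x y (f g h : cell1 x y), cell2 g h -> cell2 f g -> cell2 f h;
  hcomp : forall x y z (f f' : cell1 x y) (g g' : cell1 y z),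
    cell2 f f' -> cell2 g g' -> cell2 (comp1 f g) (comp1 f' g')
}.

Definition cell2_cast (D : TwoCatData) (x y : D) (f f' g g' : cell1 x y)
    (e : f = f') (e' : g = g') (s : cell2 f g) : cell2 f' g' :=
  match e in _ = u, e' in _ = v return cell2 u v with
  | eq_refl, eq_refl => s
  end.

Record IsTwoCategory (D : TwoCatData) : Prop := {
  vcompA : forall (x y : D) (f g h k : cell1 x y)
      (r : cell2 h k) (t : cell2 g h) (s : cell2 f g),
    vcomp r (vcomp t s) = vcomp (vcomp r t) s;
  vcomp1l : forall (x y : D) (f g : cell1 x y) (s : cell2 f g),
    vcomp (id2 g) s = s;
  vcomp1r : forall (x y : D) (f g : cell1 x y) (s : cell2 f g),
    vcomp s (id2 f) = s;
  hcomp_id2 : forall (x y z : D) (f : cell1 x y) (g : cell1 y z),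
    hcomp (id2 f) (id2 g) = id2 (comp1 f g);
  interchange : forall (x y z : D) (f f' f'' : cell1 x y) (g g' g'' : cell1 y z)
      (s' : cell2 f' f'') (s : cell2 f f') (t' : cell2 g' g'') (t : cell2 g g'),
    hcomp (vcomp s' s) (vcomp t' t) = vcomp (hcomp s' t') (hcomp s t);
  comp1A : forall (x y z w : D) (f : cell1 x y) (g : cell1 y z) (h : cell1 z w),
    comp1 f (comp1 g h) = comp1 (comp1 f g) h;
  comp1_idl : forall (x y : D) (f : cell1 x y), comp1 (id1 x) f = f;
  comp1_idr : forall (x y : D) (f : cell1 x y), comp1 f (id1 y) = f;
  hcompA : forall (x y z w : D) (f f' : cell1 x y) (g g' : cell1 y z)
      (h h' : cell1 z w) (r : cell2 f f') (s : cell2 g g') (t : cell2 h h'),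
    cell2_cast (comp1A f g h) (comp1A f' g' h') (hcomp r (hcomp s t))
    = hcomp (hcomp r s) t;
  hcomp_idl : forall (x y : D) (f f' : cell1 x y) (s : cell2 f f'),
    cell2_cast (comp1_idl f) (comp1_idl f') (hcomp (id2 (id1 x)) s) = s;
  hcomp_idr : forall (x y : D) (f f' : cell1 x y) (s : cell2 f f'),
    cell2_cast (comp1_idr f) (comp1_idr f') (hcomp s (id2 (id1 y))) = s
}.

(* The cells selected by P0, P1, P2 form a 2-subcategory: sources and targets of
   selected cells are selected, and the operations preserve selected cells. *)
Record IsTwoSubcategory (D : TwoCatData) (P0 : D -> Prop)
    (P1 : forall x y : D, cell1 x y -> Prop)
    (P2 : forall (x y : D) (f g : cell1 x y), cell2 f g -> Prop) : Prop := {
  sub_bd1 : forall x y (f : cell1 x y), P1 x y f -> P0 x /\ P0 y;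
  sub_bd2 : forall x y (f g : cell1 x y) (s : cell2 f g),
    P2 x y f g s -> P1 x y f /\ P1 x y g;
  sub_id1 : forall x, P0 x -> P1 x x (id1 x);
  sub_comp1 : forall x y z (f : cell1 x y) (g : cell1 y z),
    P1 x y f -> P1 y z g -> P1 x z (comp1 f g);
  sub_id2 : forall x y (f : cell1 x y), P1 x y f -> P2 x y f f (id2 f);
  sub_vcomp : forall x y (f g h : cell1 x y) (t : cell2 g h) (s : cell2 f g),
    P2 x y g h t -> P2 x y f g s -> P2 x y f h (vcomp t s);
  sub_hcomp : forall x y z (f f' : cell1 x y) (g g' : cell1 y z)
      (s : cell2 f f') (t : cell2 g g'),
    P2 x y f f' s -> P2 y z g g' t ->
    P2 x z (comp1 f g) (comp1 f' g') (hcomp s t)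
}.

(* The assertion that the prescribed identities and composites of maps of pairs
   and of transformations are again maps of pairs and transformations. *)
Record RepClosed (C : MonoidalCategory) (P : PRO) : Prop := {
  rep_id1_ok : forall S : EquivRep C P, IsPairMap (pm_id_data S);
  rep_comp1_ok : forall (V T S : EquivRep C P) (L : PairMap V T) (K : PairMap T S),
    IsPairMap (pm_comp_data L K);
  rep_id2_ok : forall (T S : EquivRep C P) (K : PairMap T S),
    @IsPairTrans C P T S K K (nat_id (pm_fun K));
  rep_vcomp_ok : forall (T S : EquivRep C P) (K L N : PairMap T S)
      (t : PairTrans L N) (s : PairTrans K L),
    @IsPairTrans C P T S K N (nat_vcomp t s);
  rep_hcomp_ok : forall (V T S : EquivRep C P) (L L' : PairMap V T)
      (K K' : PairMap T S) (t : PairTrans L L') (s : PairTrans K K'),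
    @IsPairTrans C P V S (pm_comp_data L K) (pm_comp_data L' K') (nat_hcomp t s)
}.

Definition RepC (C : MonoidalCategory) (P : PRO) (H : RepClosed C P) :
    TwoCatData :=
  {| cell0 := EquivRep C P;
     cell1 := fun T S => PairMap T S;
     cell2 := fun T S K L => PairTrans K L;
     id1 := fun S => {| pm_data := pm_id_data S; pm_ok := rep_id1_ok H S |};
     comp1 := fun V T S L K =>
       {| pm_data := pm_comp_data L K; pm_ok := rep_comp1_ok H L K |};
     id2 := fun T S K => {| pt_nat := nat_id (pm_fun K); pt_ok := rep_id2_ok H K |};
     vcomp := fun T S K L N t s =>
       {| pt_nat := nat_vcomp t s; pt_ok := rep_vcomp_ok H t s |};
     hcomp := fun V T S L L' K K' t s =>
       @Build_PairTrans C P V S (pm_comp_data L K) (pm_comp_data L' K')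
         (nat_hcomp t s) (rep_hcomp_ok H t s) |}.

Definition HasInvertibleCoherence (C : MonoidalCategory) (P : PRO)
    (T S : EquivRep C P) (K : PairMap T S) : Prop :=
  forall (c : C) (m : rep_act S), IsIso (cf_zeta (pm_fun K) c m).

(* Main.v *)
Require Import Defs.
From Stdlib Require Import ssreflect ProofIrrelevance.

Set Implicit Arguments.
Unset Strict Implicit.
Unset Printing Implicit Defensive.

(** All the structure is inherited from categories, functors and natural
    transformations, so only two things need an argument.

    The conditions on maps of pairs have to be stable under composition.  Write
    (K, zeta^K, alpha) and (L, zeta^L, beta) for the two maps.  The coherence
    squares of L and of K are pasted along two naturality squares, that of beta
    at zeta^K and that of zeta^L at alpha ([pm_comp_ok]).  For the intertwining
    condition the point is that the iterates of a composite paste as the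
    generators do: (L alpha o beta K)^(n) = L alpha^(n) o beta^(n) K
    ([pm_alpha_pow_comp]); the intertwining squares of L and of K for an
    operation tau then sit side by side.

    The laws of a 2-category are equations between dependent records.  A map of
    pairs is determined by its colax functor and the components of alpha
    ([pair_map_eq]), and a 2-cell by its components, a transport along
    equalities of 1-cells acting componentwise ([cell2_cast_component]).  In the
    associativity and unit laws the two composites have convertible values on
    objects, so by proof irrelevance these transports of components are trivial
    ([hom_cast_id]), and what remains are identities between morphisms of a
    single category.

    For the 2-subcategory, the coherence of a composite is
    zeta^L K o L zeta^K, and functors and composition preserve isomorphisms. *)

(** * Composites of maps of pairs and of transformations *)

Lemma act_map_compr (C : MonoidalCategory) (M : Actegory C) (c : C)
    (X Y Z : M) (g : Hom Y Z) (f : Hom X Y) :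
  act_map (idm c) (g ∘ f) = act_map (idm c) g ∘ act_map (idm c) f.
Proof. by rewrite -act_comp comp1m. Qed.

Lemma cf_zeta_natr (C : MonoidalCategory) (M N : Actegory C)
    (F : ColaxFunctor M N) (c : C) (X Y : M) (g : Hom X Y) :
  cf_zeta F c Y ∘ fmap F (act_map (idm c) g)
  = act_map (idm c) (fmap F g) ∘ cf_zeta F c X.
Proof. exact: cf_zeta_nat. Qed.

Section Cells.

Variables (C : MonoidalCategory) (P : PRO).
Implicit Types V T S : EquivRep C P.

Lemma pm_alpha_pow_id S n m :
  pm_alpha_pow (pm_id_data S) n m = idm (colax_pow (rep_gen S) n m).
Proof. by elim: n => [|n IHn] //=; rewrite IHn fmap_id comp1m. Qed.

(** The iterates of a composite are the pasted iterates: in the inductive step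
    the naturality of beta moves it past the n-th iterate of alpha. *)
Lemma pm_alpha_pow_comp V T S (L : PairMapData V T) (K : PairMapData T S) n m :
  pm_alpha_pow (pm_comp_data L K) n m
  = fmap (pm_fun L) (pm_alpha_pow K n m) ∘ pm_alpha_pow L n (pm_fun K m).
Proof.
elim: n => [|n IHn] /=; first by rewrite fmap_id comp1m.
rewrite IHn !fmap_comp -!compA; congr (_ ∘ _).
rewrite !compA; congr (_ ∘ _).
exact: (ncomp_nat (pm_alpha L) (pm_alpha_pow K n m)).
Qed.

Lemma pm_id_ok S : IsPairMap (pm_id_data S).
Proof.
split=> [c m|n p tau m] /=.
  by rewrite act_id fmap_id !comp1m compm1.
by rewrite !pm_alpha_pow_id comp1m compm1.
Qed.

Lemma pm_comp_ok V T S (L : PairMap V T) (K : PairMap T S) :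
  IsPairMap (pm_comp_data L K).
Proof.
split=> [c m|n p tau m] /=.
  have HL := pm_coherence (pm_ok L) c (pm_fun K m).
  have HK := pm_coherence (pm_ok K) c m.
  have nL := ncomp_nat (pm_alpha L) (cf_zeta (pm_fun K) c m).
  rewrite /= in nL.
  rewrite act_map_compr fmap_comp.
  (* Isolate the left side of the coherence square of L at K m; once it is
     replaced, the two naturality squares expose that of K under L. *)
  transitivity (act_map (idm c) (fmap (pm_fun L) (pm_alpha K m))
    ∘ (act_map (idm c) (pm_alpha L (pm_fun K m))
        ∘ cf_zeta (rep_gen V) c (pm_fun L (pm_fun K m))
        ∘ fmap (rep_gen V) (cf_zeta (pm_fun L) c (pm_fun K m)))
    ∘ fmap (rep_gen V) (fmap (pm_fun L) (cf_zeta (pm_fun K) c m))).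
    by rewrite !compA.
  rewrite HL -!compA nL !compA -cf_zeta_natr -!compA; congr (_ ∘ _).
  by rewrite !compA -!fmap_comp HK.
rewrite !pm_alpha_pow_comp compA -fmap_comp (pm_intertwine (pm_ok K)).
by rewrite fmap_comp -!compA (pm_intertwine (pm_ok L)).
Qed.

Lemma pt_id_ok T S (K : PairMap T S) :
  @IsPairTrans C P T S K K (nat_id (pm_fun K)).
Proof.
split; last exact: (en_equiv (en_id (pm_fun K))).
by move=> m /=; rewrite fmap_id comp1m compm1.
Qed.

(** Regarding a 2-cell as an equivariant transformation gives the equivariance
    of composites from the corresponding composites in [EquivNat]. *)
Definition pt_en T S (K L : PairMap T S) (s : PairTrans K L) :
  EquivNat (pm_fun K) (pm_fun L) := {| en_equiv := pt_equiv (pt_ok s) |}.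

Lemma pt_vcomp_ok T S (K L N : PairMap T S)
    (t : PairTrans L N) (s : PairTrans K L) :
  @IsPairTrans C P T S K N (nat_vcomp t s).
Proof.
split; last exact: (en_equiv (en_vcomp (pt_en t) (pt_en s))).
move=> m /=.
by rewrite fmap_comp compA (pt_alpha (pt_ok t)) -!compA (pt_alpha (pt_ok s)).
Qed.

Lemma pt_hcomp_ok V T S (L L' : PairMap V T) (K K' : PairMap T S)
    (t : PairTrans L L') (s : PairTrans K K') :
  @IsPairTrans C P V S (pm_comp_data L K) (pm_comp_data L' K') (nat_hcomp t s).
Proof.
split; last exact: (en_equiv (en_hcomp (pt_en t) (pt_en s))).
move=> m /=.
have nL := ncomp_nat (pm_alpha L) (s m); rewrite /= in nL.
rewrite fmap_comp -compA (compA (pm_alpha L' _)) (pt_alpha (pt_ok t)).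
rewrite -!compA nL !compA -(ncomp_nat t); congr (_ ∘ _).
by rewrite -!compA -!fmap_comp (pt_alpha (pt_ok s)).
Qed.

Lemma rep_closed : RepClosed C P.
Proof.
split.
- exact: pm_id_ok.
- exact: pm_comp_ok.
- exact: pt_id_ok.
- exact: pt_vcomp_ok.
- exact: pt_hcomp_ok.
Qed.

(** * Equality of 1-cells and of 2-cells *)

Lemma pair_map_eq T S (K L : PairMap T S) (e : pm_fun K = pm_fun L) :
  (forall m, hom_cast
      (f_equal (fun F : ColaxFunctor _ _ => rep_gen T (F m)) e)
      (f_equal (fun F : ColaxFunctor _ _ => F (rep_gen S m)) e)
      (pm_alpha K m) = pm_alpha L m) ->
  K = L.
Proof.
case: K e => [[F a] okK]; case: L => [[G b] okL] /= e.
case: G / e b okL => b okL /= E.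
have Eab : a = b by apply: nat_eq.
by subst b; congr Build_PairMap; apply: proof_irrelevance.
Qed.

Lemma pair_trans_eq T S (K L : PairMap T S) (s t : PairTrans K L) :
  (forall m, s m = t m) -> s = t.
Proof.
case: s => s ps; case: t => t pt /= E.
have Est : s = t by apply: nat_eq.
by subst t; congr Build_PairTrans; apply: proof_irrelevance.
Qed.

Lemma cell2_cast_component (H : RepClosed C P) T S
    (K K' L L' : PairMap T S) (e : K = K') (e' : L = L')
    (s : PairTrans K L) m :
  (@cell2_cast (RepC H) T S K K' L L' e e' s : PairTrans K' L') m
  = hom_cast (f_equal (fun F : PairMap T S => pm_fun F m) e)
             (f_equal (fun F : PairMap T S => pm_fun F m) e') (s m).
Proof. by case: K' / e; case: L' / e'. Qed.

Lemma pm_compA (H : RepClosed C P) (x y z w : RepC H)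
    (f : cell1 x y) (g : cell1 y z) (h : cell1 z w) :
  comp1 f (comp1 g h) = comp1 (comp1 f g) h.
Proof.
refine (@pair_map_eq x w (comp1 f (comp1 g h)) (comp1 (comp1 f g) h)
  (colax_compA (pm_fun f) (pm_fun g) (pm_fun h)) _) => m.
by rewrite hom_cast_id /= fmap_comp compA.
Qed.

Lemma pm_comp1l (H : RepClosed C P) (x y : RepC H) (f : cell1 x y) :
  comp1 (id1 x) f = f.
Proof.
refine (@pair_map_eq x y (comp1 (id1 x) f) f (colax_comp1l (pm_fun f)) _) => m.
by rewrite hom_cast_id /= compm1.
Qed.

Lemma pm_comp1r (H : RepClosed C P) (x y : RepC H) (f : cell1 x y) :
  comp1 f (id1 y) = f.
Proof.
refine (@pair_map_eq x y (comp1 f (id1 y)) f (colax_comp1r (pm_fun f)) _) => m.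
by rewrite hom_cast_id /= fmap_id comp1m.
Qed.

(** * The 2-category and its 2-subcategory *)

Lemma RepC_two_category (H : RepClosed C P) : IsTwoCategory (RepC H).
Proof.
apply: (@Build_IsTwoCategory (RepC H) _ _ _ _ _
  (@pm_compA H) (@pm_comp1l H) (@pm_comp1r H)).
- by move=> *; apply: pair_trans_eq => m /=; rewrite compA.
- by move=> *; apply: pair_trans_eq => m /=; rewrite comp1m.
- by move=> *; apply: pair_trans_eq => m /=; rewrite compm1.
- by move=> *; apply: pair_trans_eq => m /=; rewrite fmap_id comp1m.
- move=> x y z f f' f'' g g' g'' s' s t' t; apply: pair_trans_eq => m /=.
  rewrite fmap_comp -!compA; congr (_ ∘ _).
  by rewrite !compA ncomp_nat.
- move=> x y z w f f' g g' h h' r s t; apply: pair_trans_eq => m.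
  by rewrite cell2_cast_component hom_cast_id /= fmap_comp compA.
- move=> x y f f' s; apply: pair_trans_eq => m.
  by rewrite cell2_cast_component hom_cast_id /= comp1m.
- move=> x y f f' s; apply: pair_trans_eq => m.
  by rewrite cell2_cast_component hom_cast_id /= fmap_id compm1.
Qed.

End Cells.

Lemma iso_id (A : Category) (X : A) : IsIso (idm X).
Proof. by exists (idm X); rewrite comp1m. Qed.

Lemma iso_comp (A : Category) (X Y Z : A) (g : Hom Y Z) (f : Hom X Y) :
  IsIso g -> IsIso f -> IsIso (g ∘ f).
Proof.
move=> [g' [g'g gg']] [f' [f'f ff']]; exists (f' ∘ g'); split.
  by rewrite -compA (compA g') g'g comp1m.
by rewrite -compA (compA f) ff' comp1m.
Qed.

Lemma iso_fmap (A B : Category) (F : Functor A B) (X Y : A) (f : Hom X Y) :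
  IsIso f -> IsIso (fmap F f).
Proof.
by move=> [g [gf fg]]; exists (fmap F g); rewrite -!fmap_comp gf fg !fmap_id.
Qed.

Lemma RepC_invertible_two_subcategory (C : MonoidalCategory) (P : PRO)
    (H : RepClosed C P) :
  @IsTwoSubcategory (RepC H)
    (fun _ => True)
    (fun T S K => HasInvertibleCoherence K)
    (fun T S K L _ => HasInvertibleCoherence K /\ HasInvertibleCoherence L).
Proof.
have comp_inv (x y z : RepC H) (f : cell1 x y) (g : cell1 y z) :
    HasInvertibleCoherence f -> HasInvertibleCoherence g ->
    HasInvertibleCoherence (comp1 f g : PairMap x z).
  move=> Hf Hg c m; apply: iso_comp; first exact: Hf.
  by apply: iso_fmap; apply: Hg.
split=> //.
- by move=> x _ c m; apply: iso_id.
- by move=> x y f g h t s [_ Hh] [Hf _].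
- by move=> x y z f f' g g' s t [Hf Hf'] [Hg Hg']; split; apply: comp_inv.
Qed.

Theorem mainTheorem7 (C : MonoidalCategory) (P : PRO) :
  exists H : RepClosed C P,
    IsTwoCategory (RepC H) /\
    @IsTwoSubcategory (RepC H)
      (fun _ => True)
      (fun T S K => HasInvertibleCoherence K)
      (fun T S K L _ => HasInvertibleCoherence K /\ HasInvertibleCoherence L).
Proof.
exists (rep_closed C P); split; first exact: RepC_two_category.
exact: RepC_invertible_two_subcategory.
Qed.
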